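(* Let $p$ be a prime and $d\ge 1$ an integer. Let $\mathcal{C}_0$ be the complex of balls in $\mathbb{Q}_p^d$ containing zero, with respect to the family of all metrics $s^{A}_{q_1,\dots,q_d}$ (where $A\in \mathrm{GL}_d(\mathbb{Q}_p)$ and $q_1,\dots,q_d>0$), and let $\Gamma=\{x\mapsto p^k x : k\in\mathbb{Z}\}$ be the group of dilations acting on $\mathcal{C}_0$. Every ball containing zero with respect to one of these metrics is a lattice in $\mathbb{Q}_p^d$, and the map sending the $\Gamma$-orbit of a ball $I$ containing zero to the equivalence class of the lattice $I$ is an isomorphism of simplicial complexes from $\mathcal{C}_0/\Gamma$ onto the affine Bruhat--Tits building of $\mathbb{Q}_p^d$.
   Context: Norms and metrics. For $q_1,\dots,q_d>0$ and $A\in \mathrm{GL}_d(\mathbb{Q}_p)$ put $N_{q_1,\dots,q_d}(z)=\max_{i=1,\dots,d}(q_i|z_i|_p)$ for $z\in\mathbb{Q}_p^d$, $N^{A}_{q_1,\dots,q_d}(z)=N_{q_1,\dots,q_d}(Az)$, and $s^{A}_{q_1,\dots,q_d}(x,y)=N^{A}_{q_1,\dots,q_d}(x-y)$. For such a metric $s$, an $s$-ball is a set $\{y: s(x,y)\le r\}$ with $x\in\mathbb{Q}_p^d$, $r>0$. If $I$ is an $s$-ball containing zero, so is $p^kI$ for every $k\in\mathbb{Z}$. The complex $\mathcal{C}_0$. Its vertices are all subsets of $\mathbb{Q}_p^d$ which contain $0$ and are $s$-balls for at least one metric $s=s^{A}_{q_1,\dots,q_d}$ (balls for different metrics that coincide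 as sets are identified). For $k\ge 1$, a $(k-1)$-simplex is a set $\{I_1,\dots,I_k\}$ of $k$ balls which are all $s$-balls containing zero for one common metric $s$ of the family and satisfy $pI_k\subsetneq I_1\subsetneq I_2\subsetneq\dots\subsetneq I_k$ (simplices arising from different metrics and coinciding as sets of balls are identified). The quotient $\mathcal{C}_0/\Gamma$. Its vertices are the $\Gamma$-orbits of vertices of $\mathcal{C}_0$ and its simplices are the images of simplices of $\mathcal{C}_0$. Affine Bruhat--Tits building of $\mathbb{Q}_p^d$. A lattice in $\mathbb{Q}_p^d$ is an open compact $\mathbb{Z}_p$-submodule. Two lattices are equivalent if one is a scalar multiple of the other (by a nonzero element of $\mathbb{Q}_p$). Vertices of the building are the equivalence classes of lattices. For $1\le k\le d$, a $(k-1)$-simplex is a set of $k$ distinct vertices that have representatives $L_1,\dots,L_k$ with $pL_k\subsetneq L_1\subsetneq L_2\subsetneq\dots\subsetneq L_k$. *)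

(* Defs.v *)
From HB Require Import structures.
From mathcomp Require Import all_boot all_order all_algebra.
From mathcomp Require Import all_classical all_reals topology.

Set Implicit Arguments.
Unset Strict Implicit.
Unset Printing Implicit Defensive.

Import Order.TTheory GRing.Theory Num.Theory.

Local Open Scope classical_set_scope.
Local Open Scope ring_scope.

(* The ring Z_p = lim Z/p^n: x n is the representative in [0, p^n) of the
   residue of x modulo p^n. *)

Record padic_int (p : nat) (p_pr : prime p) := PadicInt {
  residue :> nat -> nat;
  _ : `[< forall n, (residue n = residue n.+1 %% p ^ n)%N >] }.

HB.instance Definition _ (p : nat) (p_pr : prime p) :=
  [isSub for @residue p p_pr].
HB.instance Definition _ (p : nat) (p_pr : prime p) :=
  [Choice of padic_int p_pr by <:].

Section PadicInt.
Variables (p : nat) (p_pr : prime p).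
Local Notation Zp := (padic_int p_pr).
Implicit Types x y z : Zp.

Lemma residueE x n : (x n = x n.+1 %% p ^ n)%N.
Proof. by case: x => f /= /asboolP. Qed.

Lemma residue_lt x n : (x n < p ^ n)%N.
Proof. by rewrite residueE ltn_mod expn_gt0 prime_gt0. Qed.

Lemma residue_mod x m n : (m <= n)%N -> (x n %% p ^ m = x m)%N.
Proof.
move=> /subnK <-; elim: (n - m)%N => [|k IHk].
  by rewrite add0n modn_small ?residue_lt.
by rewrite -IHk (residueE x (k + m)) modn_dvdm // dvdn_exp2l ?leq_addl.
Qed.

Lemma padic_intP x y : (forall n, x n = y n) -> x = y.
Proof. by move=> xy; apply/val_inj/funext. Qed.

Lemma of_coherent_subproof (f : nat -> nat) :
  (forall n, f n.+1 = f n %[mod p ^ n]) ->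
  `[< forall n, (f n %% p ^ n = (f n.+1 %% p ^ n.+1) %% p ^ n)%N >].
Proof.
by move=> fP; apply/asboolP => n; rewrite modn_dvdm ?fP // dvdn_exp2l.
Qed.

Definition of_coherent (f : nat -> nat)
    (fP : forall n, f n.+1 = f n %[mod p ^ n]) : Zp :=
  @PadicInt p p_pr _ (of_coherent_subproof fP).

Lemma natp_subproof (a : nat) n : a = a %[mod p ^ n]. Proof. by []. Qed.
Lemma addp_subproof x y n : (x n.+1 + y n.+1 = x n + y n %[mod p ^ n])%N.
Proof. by rewrite -modnDm -!residueE. Qed.
Lemma mulp_subproof x y n : (x n.+1 * y n.+1 = x n * y n %[mod p ^ n])%N.
Proof. by rewrite -modnMm -!residueE. Qed.
Lemma oppp_subproof x n :
  (p ^ n.+1 - x n.+1 = p ^ n - x n %[mod p ^ n])%N.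
Proof.
apply/eqP; rewrite -(eqn_modDr (x n.+1)) subnK ?(ltnW (residue_lt _ _)) //.
rewrite -(modnDmr (p ^ n - x n)) -residueE subnK ?(ltnW (residue_lt _ _)) //.
by rewrite modnn expnS modnMl.
Qed.

Definition zerop : Zp := of_coherent (natp_subproof 0).
Definition onep : Zp := of_coherent (natp_subproof 1).
Definition addp x y : Zp := of_coherent (addp_subproof x y).
Definition mulp x y : Zp := of_coherent (mulp_subproof x y).
Definition oppp x : Zp := of_coherent (oppp_subproof x).

Lemma addpA : associative addp.
Proof. by move=> x y z; apply: padic_intP => n /=; rewrite modnDml modnDmr addnA. Qed.
Lemma addpC : commutative addp.
Proof. by move=> x y; apply: padic_intP => n /=; rewrite addnC. Qed.
Lemma add0p : left_id zerop addp.
Proof.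
by move=> x; apply: padic_intP => n /=; rewrite mod0n add0n modn_small ?residue_lt.
Qed.
Lemma addNp : left_inverse zerop oppp addp.
Proof.
move=> x; apply: padic_intP => n /=.
by rewrite modnDml subnK ?(ltnW (residue_lt _ _)) // modnn mod0n.
Qed.
HB.instance Definition _ := GRing.isZmodule.Build Zp addpA addpC add0p addNp.

Lemma mulpA : associative mulp.
Proof. by move=> x y z; apply: padic_intP => n /=; rewrite modnMml modnMmr mulnA. Qed.
Lemma mulpC : commutative mulp.
Proof. by move=> x y; apply: padic_intP => n /=; rewrite mulnC. Qed.
Lemma mul1p : left_id onep mulp.
Proof.
by move=> x; apply: padic_intP => n /=; rewrite modnMml mul1n modn_small ?residue_lt.
Qed.
Lemma mulpDl : left_distributive mulp addp.
Proof.
move=> x y z; apply: padic_intP => n /=.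
by rewrite modnMml modnDml modnDmr mulnDl.
Qed.
Lemma onep_neq0 : onep != 0.
Proof.
apply/eqP => /(congr1 (fun x : Zp => x 1%N)) /=.
by rewrite expn1 mod0n modn_small ?prime_gt1.
Qed.
HB.instance Definition _ :=
  GRing.Zmodule_isComNzRing.Build Zp mulpA mulpC mul1p mulpDl onep_neq0.

Definition unitp : pred Zp := [pred x | `[< exists y, y * x = 1 >]].
Definition invp x : Zp :=
  if pselect (exists y, y * x = 1) is left h then sval (cid h) else x.
Lemma mulVp : {in unitp, left_inverse 1 invp *%R}.
Proof.
by move=> x /asboolP xU; rewrite /invp; case: pselect => // h; case: cid.
Qed.
Lemma unitpP x y : y * x = 1 -> unitp x.
Proof. by move=> yx; apply/asboolP; exists y. Qed.
Lemma invp_out : {in [predC unitp], invp =1 id}.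
Proof.
move=> x; rewrite inE /= => xU; rewrite /invp; case: pselect => // h.
by case/asboolP: xU.
Qed.
HB.instance Definition _ :=
  GRing.ComNzRing_hasMulInverse.Build Zp mulVp unitpP invp_out.

Lemma residue0 n : (0 : Zp) n = 0%N. Proof. exact: mod0n. Qed.
Lemma residueD x y n : (x + y) n = ((x n + y n) %% p ^ n)%N. Proof. by []. Qed.
Lemma residueM x y n : (x * y) n = ((x n * y n) %% p ^ n)%N. Proof. by []. Qed.

Lemma padic_int_neq0 x : x != 0 -> exists n, x n.+1 != 0%N.
Proof.
move=> x0; apply: contrapT => /forallNP xN; case/eqP: x0; apply: padic_intP => n.
rewrite residue0; case: n => [|n]; last by apply/eqP; have /negP/negPn := xN n.
by rewrite (residueE x 0%N) expn0 modn1.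
Qed.

(* The p-adic valuation; it is set to 0 at 0. *)
Definition vali (x : Zp) : nat :=
  if pselect (exists n, x n.+1 != 0%N) is left h then ex_minn h else 0%N.

Lemma vali_logn x n : x != 0 -> (vali x < n)%N ->
  (0 < x n)%N /\ logn p (x n) = vali x.
Proof.
move=> /padic_int_neq0 x0; rewrite /vali; case: pselect => // h.
case: ex_minnP => v xv vmin vn.
have xn0 : (0 < x n)%N.
  by rewrite lt0n; apply: contra xv => /eqP xn; rewrite -(residue_mod x vn) xn mod0n.
split=> //; apply/eqP; rewrite eqn_leq -ltnS ltnNge -pfactor_dvdn //.
rewrite -[X in _ && X]pfactor_dvdn //; apply/andP; split.
  by rewrite /dvdn residue_mod.
rewrite /dvdn residue_mod 1?ltnW //.
case: v {vn xv} vmin => [|v] vmin; first by rewrite (residueE x 0%N) expn0 modn1.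
by apply: contraT => /vmin; rewrite ltnn.
Qed.

Lemma dvdn_residue x n k : x != 0 -> (n <= k)%N ->
  (p ^ n %| x k)%N = (n <= vali x)%N.
Proof.
move=> x0 nk; have [y0 yl] := vali_logn x0 (leq_addl k (vali x).+1).
have -> : (p ^ n %| x k)%N = (p ^ n %| x (k + (vali x).+1))%N.
  by rewrite /dvdn !residue_mod // (leq_trans nk) // leq_addr.
by rewrite pfactor_dvdn // yl.
Qed.

Lemma mulp_vali x y : x != 0 -> y != 0 ->
  x * y != 0 /\ vali (x * y) = (vali x + vali y)%N.
Proof.
move=> x0 y0; set v := (vali x + vali y)%N.
have [xp xl] := vali_logn x0 (leq_addr (vali y) (vali x).+1 : (vali x < v.+1)%N).
have [yp yl] := vali_logn y0 (leq_addl (vali x) (vali y).+1).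
rewrite addnS -/v in yp yl.
have lxy : logn p (x v.+1 * y v.+1) = v by rewrite lognM // xl yl.
have xy0 : x * y != 0.
  apply/eqP => /(congr1 (fun z : Zp => z v.+1)) /eqP.
  rewrite residue0 residueM -/(dvdn _ _) pfactor_dvdn //; last by rewrite muln_gt0 xp.
  by rewrite lxy ltnn.
split=> //; apply/eqP; rewrite eqn_leq.
rewrite -[X in X && _]negbK -ltnNge -(dvdn_residue (k := v.+1)) //.
rewrite -[X in _ && X](dvdn_residue (k := v.+1)) //.
rewrite residueM {1}/dvdn modn_mod -/(dvdn _ _).
rewrite [X in _ && X]/dvdn modn_dvdm ?dvdn_exp2l // -/(dvdn _ _).
by rewrite !pfactor_dvdn ?muln_gt0 ?xp // lxy ltnn leqnn.
Qed.

Lemma padic_int_integral x y : x * y = 0 -> (x == 0) || (y == 0).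
Proof.
move=> xy; apply: contraT; rewrite negb_or => /andP[x0 y0].
by have [] := mulp_vali x0 y0; rewrite xy eqxx.
Qed.
HB.instance Definition _ :=
  GRing.ComUnitRing_isIntegral.Build Zp padic_int_integral.

Lemma vali_ultra x y n : x + y != 0 ->
  (x == 0) || (n <= vali x)%N -> (y == 0) || (n <= vali y)%N ->
  (n <= vali (x + y)%R)%N.
Proof.
move=> xy0 xn yn; rewrite -(dvdn_residue (k := n)) //.
have dv z : (z == 0) || (n <= vali z)%N -> (p ^ n %| z n)%N.
  case: eqVneq => [->|z0] /=; first by rewrite mod0n dvdn0.
  by rewrite (dvdn_residue (k := n)).
by rewrite residueD /dvdn modn_mod -/(dvdn _ _) dvdn_add // dv.
Qed.

(* The p-adic absolute value on Z_p; it takes rational values. *)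
Definition absi (x : Zp) : rat := if x == 0 then 0 else p%:R ^- vali x.

Let p_gt0 : 0 < p%:R :> rat. Proof. by rewrite ltr0n prime_gt0. Qed.

Lemma absi_ge0 x : 0 <= absi x.
Proof. by rewrite /absi; case: ifP => // _; rewrite invr_ge0 exprn_ge0 ?ltW. Qed.

Lemma absi_eq0 x : (absi x == 0) = (x == 0).
Proof.
rewrite /absi; case: ifP => [|_]; first by rewrite eqxx.
by rewrite invr_eq0 expf_eq0 gt_eqF // andbF.
Qed.

Lemma absiM x y : absi (x * y) = absi x * absi y.
Proof.
rewrite /absi mulf_eq0.
case: eqVneq => [|x0] /=; first by rewrite mul0r.
case: eqVneq => [|y0] /=; first by rewrite mulr0.
by have [_ ->] := mulp_vali x0 y0; rewrite exprD invfM.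
Qed.

Lemma absi1 : absi 1 = 1.
Proof.
have a0 : absi 1 != 0 by rewrite absi_eq0 oner_eq0.
by apply: (mulfI a0); rewrite -absiM !mulr1.
Qed.

Lemma absiN x : absi (- x) = absi x.
Proof.
have a1 : absi (-1) = 1.
  apply/eqP; rewrite -(@eqrXn2 _ 2) ?absi_ge0 //; apply/eqP.
  by rewrite expr2 -absiM mulrNN mulr1 expr1n absi1.
by rewrite -mulN1r absiM a1 mul1r.
Qed.

Lemma absi_le x n :
  (absi x <= p%:R ^- n) = (x == 0) || (n <= vali x)%N.
Proof.
rewrite /absi; case: eqVneq => /= [_|x0]; first by rewrite invr_ge0 exprn_ge0 ?ltW.
by rewrite lef_pV2 ?posrE ?exprn_gt0 // ler_eXn2l // ltr1n prime_gt1.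
Qed.

Lemma absiD x y : absi (x + y) <= Num.max (absi x) (absi y).
Proof.
have [-> |xy0] := eqVneq (x + y) 0.
  by rewrite /absi eqxx le_max absi_ge0.
wlog xy : x y xy0 / absi x <= absi y.
  move=> W; have /orP[|yx] := le_total (absi x) (absi y); first exact: W.
  by rewrite addrC maxC W // addrC.
rewrite le_max; apply/orP; right.
have [y0|y0] := eqVneq y 0.
  suff x0 : x = 0 by rewrite x0 y0 addr0 eqxx in xy0.
  by apply/eqP; rewrite -absi_eq0 eq_le absi_ge0 (le_trans xy) // y0 /absi eqxx.
have ay : absi y = p%:R ^- vali y by rewrite /absi (negbTE y0).
rewrite ay absi_le (negbTE xy0) /=; apply: vali_ultra => //.
  by rewrite -absi_le -ay.
by rewrite leqnn orbT.
Qed.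

End PadicInt.

(* Q_p, as the field of fractions of Z_p *)
Definition padic (p : nat) (p_pr : prime p) := {fraction (padic_int p_pr)}.

HB.instance Definition _ (p : nat) (p_pr : prime p) :=
  GRing.Field.on (padic p_pr).

Section Padic.
Variables (p : nat) (p_pr : prime p).
Local Notation Qp := (padic p_pr).
Implicit Types x y z : Qp.

(* |a / b|_p = |a|_p / |b|_p, computed on a chosen representative;
   independence of the choice is padic_abs_frac. *)
Definition padic_abs (x : Qp) : rat :=
  absi (\n_(repr x)) / absi (\d_(repr x)).

Definition padic_of_int (a : padic_int p_pr) : Qp := FracField.tofrac a.

HB.instance Definition _ := GRing.RMorphism.copy padic_of_int
  (@FracField.tofrac (padic_int p_pr)).

Lemma padic_of_int_eq0 a : (padic_of_int a == 0) = (a == 0).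
Proof. exact: tofrac_eq0. Qed.

Lemma padic_fracP x : exists a b : padic_int p_pr,
  [/\ b != 0, x = padic_of_int a / padic_of_int b & padic_abs x = absi a / absi b].
Proof.
exists \n_(repr x), \d_(repr x); split => //; first exact: denom_ratioP.
rewrite -{1}[x]reprK; set r := repr x.
apply: (@mulIf _ (padic_of_int \d_r)).
  by rewrite padic_of_int_eq0; exact: denom_ratioP.
rewrite divfK ?padic_of_int_eq0 ?denom_ratioP // /padic_of_int.
unlock FracField.tofrac; rewrite -[LHS]FracField.pi_mul; apply/eqmodP.
rewrite /= FracField.equivfE /FracField.mulf /= !numden_Ratio ?mulf_neq0 ?oner_eq0 ?denom_ratioP //.
by rewrite !mulr1 mulrC.
Qed.

Lemma padic_abs_frac (a b : padic_int p_pr) : b != 0 ->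
  padic_abs (padic_of_int a / padic_of_int b) = absi a / absi b.
Proof.
move=> b0; have [a' [b' [b'0 e ->]]] := padic_fracP (padic_of_int a / padic_of_int b).
have /eqP : a * b' = a' * b.
  apply/eqP; rewrite -subr_eq0 -padic_of_int_eq0 rmorphB !rmorphM subr_eq0.
  by move/eqP: e; rewrite eqr_div ?padic_of_int_eq0.
move/eqP/(congr1 (@absi p p_pr)); rewrite !absiM => e'.
by apply/eqP; rewrite eqr_div ?absi_eq0 // e'.
Qed.

Lemma padic_abs_of_int (a : padic_int p_pr) : padic_abs (padic_of_int a) = absi a.
Proof.
have := padic_abs_frac a (oner_neq0 (padic_int p_pr)).
by rewrite rmorph1 divr1 => ->; rewrite absi1 divr1.
Qed.

Lemma padic_abs_ge0 x : 0 <= padic_abs x.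
Proof. by rewrite /padic_abs divr_ge0 ?absi_ge0. Qed.

Lemma padic_abs_eq0 x : (padic_abs x == 0) = (x == 0).
Proof.
have [a [b [b0 -> ->]]] := padic_fracP x.
by rewrite !mulf_eq0 !invr_eq0 !absi_eq0 (negbTE b0) !padic_of_int_eq0 (negbTE b0).
Qed.

Lemma padic_absM x y : padic_abs (x * y) = padic_abs x * padic_abs y.
Proof.
have [a [b [b0 -> ->]]] := padic_fracP x.
have [c [d [d0 -> ->]]] := padic_fracP y.
rewrite mulf_div -!rmorphM padic_abs_frac ?mulf_neq0 //.
by rewrite !absiM mulf_div.
Qed.

Lemma padic_absN x : padic_abs (- x) = padic_abs x.
Proof.
have [a [b [b0 -> ->]]] := padic_fracP x.
by rewrite -mulNr -rmorphN padic_abs_frac // absiN.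
Qed.

Lemma padic_absD x y : padic_abs (x + y) <= Num.max (padic_abs x) (padic_abs y).
Proof.
have [a [b [b0 -> ->]]] := padic_fracP x.
have [c [d [d0 -> ->]]] := padic_fracP y.
rewrite addf_div ?padic_of_int_eq0 // -!rmorphM -rmorphD.
rewrite padic_abs_frac ?mulf_neq0 //.
have ab : 0 < absi b by rewrite lt_def absi_eq0 b0 absi_ge0.
have ad : 0 < absi d by rewrite lt_def absi_eq0 d0 absi_ge0.
rewrite ler_pdivrMr ?absiM ?mulr_gt0 // maxr_pMl ?mulr_ge0 ?absi_ge0 //.
rewrite mulrA divfK ?gt_eqF // [absi b * _]mulrC [absi c / _ * _]mulrA divfK ?gt_eqF //.
by rewrite (le_trans (absiD _ _)) // !absiM.
Qed.

(* Normalisation |p|_p = 1/p. *)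
Lemma padic_abs_p : padic_abs p%:R = p%:R^-1.
Proof.
have -> : p%:R = padic_of_int p%:R :> Qp by rewrite rmorph_nat.
rewrite padic_abs_of_int /absi.
have pE k n : (k%:R : padic_int p_pr) n = (k %% p ^ n)%N.
  elim: k => [|k IHk]; first by rewrite residue0 mod0n.
  by rewrite -addn1 natrD residueD IHk modnDm.
have p2 : (p%:R : padic_int p_pr) 2 != 0%N.
  rewrite pE modn_small -?lt0n ?prime_gt0 //.
  by rewrite -{1}(expn1 p) ltn_exp2l // prime_gt1.
have -> : (p%:R == 0 :> padic_int p_pr) = false.
  by apply: contraNF p2 => /eqP ->; rewrite residue0.
suff -> : vali (p%:R : padic_int p_pr) = 1%N by rewrite expr1.
rewrite /vali; case: pselect => [h|]; last by case; exists 1%N.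
case: ex_minnP => -[|[|v]] //; first by rewrite pE expn1 modnn.
by move=> _ /(_ 1%N p2).
Qed.

Let dist x y : rat := padic_abs (x - y).
Lemma padic_distxx x : dist x x = 0.
Proof. by apply/eqP; rewrite padic_abs_eq0 subrr. Qed.
Lemma padic_dist_eq0 x y : dist x y = 0 -> x = y.
Proof. by move/eqP; rewrite padic_abs_eq0 subr_eq0 => /eqP. Qed.
Lemma padic_distC x y : dist x y = dist y x.
Proof. by rewrite /dist -opprB padic_absN. Qed.
Lemma padic_dist_triangle y x z : dist x z <= dist x y + dist y z.
Proof.
rewrite /dist -[x - z](subrKA y) (le_trans (padic_absD _ _)) // ge_max.
by rewrite lerDl lerDr !padic_abs_ge0.
Qed.
(* The absolute value being rational-valued, Q_p is a metric space over rat;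
   column vectors then carry the product topology. *)
HB.instance Definition _ := isMetric.Build rat Qp
  padic_distxx padic_dist_eq0 padic_distC padic_dist_triangle.

End Padic.

Record complex (T : Type) := Complex {
  vertices : set T;
  simplices : set (set T) }.

Definition simplicial (T : Type) (K : complex T) :=
  [/\ forall S, simplices K S ->
        [/\ finite_set S, S !=set0 & S `<=` vertices K],
      forall v, vertices K v -> simplices K [set v]
    & forall S S', simplices K S -> S' !=set0 -> S' `<=` S -> simplices K S'].

Definition simplicial_iso (T U : Type) (K : complex T) (L : complex U)
    (f : T -> U) :=
  [/\ simplicial K, simplicial L, set_bij (vertices K) (vertices L) f
    & forall S, S `<=` vertices K -> (simplices K S <-> simplices L (f @` S))].

Section Complexes.
Variables (R : realType) (p : nat) (p_pr : prime p) (d : nat).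
Local Notation Qp := (padic p_pr).
Local Notation V := 'cV[Qp]_d.
Implicit Types (I J L M : set V) (s : V -> V -> R).

(* N_{q_1,...,q_d}; the entries are nonnegative, so the initial value 0 of
   the iterated maximum is harmless for d >= 1. *)
Definition pnorm (q : 'I_d -> R) (z : V) : R :=
  \big[Num.max/0]_(i < d) (q i * ratr (padic_abs (z i 0))).

Definition pmetric (A : 'M[Qp]_d) (q : 'I_d -> R) (x y : V) : R :=
  pnorm q (A *m (x - y)).

Definition pmetrics : set (V -> V -> R) :=
  [set s | exists A q,
    [/\ A \in unitmx, forall i, 0 < q i & s = pmetric A q]].

Definition is_ball s I :=
  exists (x : V) (r : R), 0 < r /\ I = [set y | s x y <= r].

Definition is_ball0 s I := is_ball s I /\ I 0.

Definition balls0 : set (set V) := [set I | exists2 s, pmetrics s & is_ball0 s I].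

Definition scale_set (c : Qp) I : set V := ( *:%R c) @` I.

Definition dilate (k : int) I : set V := scale_set (p%:R ^ k) I.

(* p I_k < I_1 < ... < I_k (strict inclusions), for a chain of k = m.+1 sets *)
Definition pchain m (I : 'I_m.+1 -> set V) :=
  dilate 1 (I ord_max) `<` I ord0 /\
  {homo I : i j / (i < j)%N >-> i `<` j}.

Definition gamma_orbit I : set (set V) := [set J | exists k, J = dilate k I].

Definition padic_submodule L :=
  [/\ L 0, forall x y, L x -> L y -> L (x + y)
    & forall (a : padic_int p_pr) x, L x -> L (padic_of_int a *: x)].

Definition lattice L := [/\ open L, compact L & padic_submodule L].

Definition lattice_class L : set (set V) :=
  [set M | lattice M /\ exists2 c : Qp, c != 0 & M = scale_set c L].

Definition ball_complex : complex (set V) :=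
  Complex balls0
    [set S | exists2 s, pmetrics s &
      exists (m : nat) (I : 'I_m.+1 -> set V),
        [/\ forall i, is_ball0 s (I i), pchain I & S = range I]].

Definition ball_complex_quotient : complex (set (set V)) :=
  Complex (gamma_orbit @` vertices ball_complex)
    [set gamma_orbit @` S | S in simplices ball_complex].

Definition bruhat_tits : complex (set (set V)) :=
  Complex [set lattice_class L | L in lattice]
    [set S | exists (m : nat) (L : 'I_m.+1 -> set V),
      [/\ (m < d)%N, forall i, lattice (L i), pchain L,
          injective (fun i => lattice_class (L i))
        & S = range (fun i => lattice_class (L i))]].

End Complexes.

Arguments balls0 R {p} p_pr d.
Arguments ball_complex R {p} p_pr d.
Arguments ball_complex_quotient R {p} p_pr d.
Arguments bruhat_tits {p} p_pr d.

(* Main.v *)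
Require Import Defs.
From HB Require Import structures.
From mathcomp Require Import all_boot all_order all_algebra.
From mathcomp Require Import cyclic.
From mathcomp Require Import all_classical all_reals topology.

Set Implicit Arguments.
Unset Strict Implicit.
Unset Printing Implicit Defensive.

Import Order.TTheory GRing.Theory Num.Theory.

Local Open Scope classical_set_scope.
Local Open Scope ring_scope.

(** The isomorphism is the identity. A lattice is stable under the units of
    Z_p, so a homothety x |-> c x acts on it as the dilation by the power of p
    having the absolute value of c: the orbit of a lattice under the dilations
    is its whole equivalence class ([gamma_orbit_lattice]). It remains to see
    that the two complexes have the same vertices and the same simplices, and
    that the building is a simplicial complex.

    A ball around 0 is a Z_p-submodule because the norm is ultrametric and
    homogeneous, and it is squeezed between two multiples of Z_p^d because all
    norms in the family are equivalent. For a submodule this squeezing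
    is the same as being open and compact ([latticeP]), which rests on the
    compactness of Z_p^d ([compact_cube]).

    Conversely, let p L_m < L_0 < ... < L_m be lattices. They have a common
    adapted basis ([adapted_basis]): a basis (b_j) and indices t_j such that L_i
    consists of the sums of x_j b_j with |x_j| <= 1 for t_j <= i and
    |x_j| <= 1/p for i < t_j. Such a basis is found along the standard flag: b_j
    has vanishing coordinates before the j-th one, its j-th coordinate has the
    largest absolute value possible in L_m, and t_j is the first level where
    this value occurs. Choose radii r_0 < ... < r_m in [1, 2[, hence in [1, p[,
    and give b_j the norm r_(t_j). Since |x_j| is 0 or a power of p,
    r_(t_j) |x_j| <= r_i holds exactly when x_j satisfies the bound above, so
    L_i is the ball of radius r_i ([chain_balls]).

    The same basis bounds the length of the chain: strictness of all m + 1
    inclusions forces every level to be some t_j, so m < d ([chain_length]).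
    A chain also consists of pairwise inequivalent lattices, since two
    homothetic lattices L, M satisfy L <= M or M <= p L
    ([pchain_class_inj]). So the dimension bound and the distinctness required
    in the building hold for every chain of balls, and a subset
    of a simplex, being given by a subchain, is again a simplex. *)

(** * Divisibility in Z_p *)

Section PadicIntegers.
Variables (p : nat) (p_pr : prime p).
Local Notation Zp := (padic_int p_pr).
Implicit Types x y : Zp.

Let p_neq0 : p%:R != 0 :> rat. Proof. by rewrite pnatr_eq0 -lt0n prime_gt0. Qed.

Lemma residue_nat k n : (k%:R : Zp) n = (k %% p ^ n)%N.
Proof.
elim: k => [|k IHk]; first by rewrite mulr0n residue0 mod0n.
by rewrite -addn1 natrD residueD IHk modnDm.
Qed.

Lemma absi_le_residue x n : (absi x <= p%:R ^- n) = (x n == 0%N).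
Proof.
rewrite absi_le; have [->|x0] := eqVneq x 0; first by rewrite residue0 eqxx.
rewrite orFb.
by rewrite -(dvdn_residue (k := n)) // /dvdn modn_small ?residue_lt.
Qed.

Lemma absi_sub_residue x y n : x n = y n -> absi (x - y) <= p%:R ^- n.
Proof.
move=> xy; rewrite absi_le_residue; apply/eqP.
have yn : (- y + y) n = 0%N by rewrite addNr residue0.
by move: yn; rewrite !residueD addnC xy addnC.
Qed.

(** The quotient by p^v at precision n is read off the residue of x at
    precision n + v. *)
Lemma residue_dvd x v :
  absi x <= p%:R ^- v -> exists y, x = (p ^ v)%:R * y.
Proof.
move=> xv; have dv n : (p ^ v %| x (n + v))%N.
  by rewrite /dvdn residue_mod ?leq_addl // -absi_le_residue.
pose f n := (x (n + v) %/ p ^ v)%N.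
have pv0 : (0 < p ^ v)%N by rewrite expn_gt0 prime_gt0.
have fP n : (f n.+1 = f n %[mod p ^ n])%N.
  apply/eqP; rewrite -(eqn_pmul2r pv0) !muln_modl -expnD /f !divnK ?dv //.
  by rewrite addSn -residueE modn_small ?residue_lt.
exists (of_coherent p_pr fP); apply: padic_intP => n.
by rewrite residueM residue_nat modnMm mulnC divnK // residue_mod // leq_addr.
Qed.

(** Euler's theorem inverts every residue of x, and inverses modulo p^n
    are unique, hence coherent. *)
Lemma padic_int_inverse x : x 1%N != 0%N -> exists y, x * y = 1.
Proof.
move=> x1; have co n : coprime (x n) (p ^ n).
  case: n => [|n]; first by rewrite expn0 coprimen1.
  rewrite coprimeXr // coprime_sym prime_coprime //; apply: contra x1.
  by rewrite -(residue_mod x (ltn0Sn n)) expn1.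
pose f n := (x n ^ (totient (p ^ n)).-1)%N.
have fE n : (x n * f n = 1 %[mod p ^ n])%N.
  rewrite /f -expnS prednK ?totient_gt0 ?expn_gt0 ?prime_gt0 //.
  exact: Euler_exp_totient.
have fP n : (f n.+1 = f n %[mod p ^ n])%N.
  (* both are inverses of x n modulo p ^ n *)
  have gE : (x n * f n.+1 = 1 %[mod p ^ n])%N.
    rewrite (residueE x n) modnMml -(modn_dvdm _ (dvdn_exp2l p (leqnSn n))).
    by rewrite fE modn_dvdm // dvdn_exp2l.
  rewrite -[in LHS](muln1 (f n.+1)) -modnMmr -(fE n) modnMmr.
  by rewrite mulnA [(f n.+1 * _)%N]mulnC -modnMml gE modnMml mul1n.
exists (of_coherent p_pr fP); apply: padic_intP => n.
by rewrite residueM modnMmr fE.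
Qed.

Lemma absi_exp_p v : absi ((p ^ v)%:R : Zp) = p%:R ^- v.
Proof.
rewrite natrX -exprVn; elim: v => [|v IHv]; first by rewrite absi1.
rewrite !exprS absiM IHv -(padic_abs_p p_pr) -padic_abs_of_int.
by rewrite /= rmorph_nat.
Qed.

Lemma absi_dvd x y : y != 0 -> absi x <= absi y -> exists z, x = y * z.
Proof.
move=> y0; have yE : absi y = p%:R ^- vali y by rewrite /absi (negbTE y0).
have [u uE] : exists u, y = (p ^ vali y)%:R * u.
  by apply: residue_dvd; rewrite yE.
have [w wu] : exists w, u * w = 1.
  apply: padic_int_inverse; rewrite -absi_le_residue -ltNge expr1.
  have := absiM (p ^ vali y)%:R u; rewrite -uE yE absi_exp_p.
  move/(congr1 ( *%R (p%:R ^+ vali y))); rewrite mulVKf ?mulfV ?expf_neq0 //.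
  by move<-; rewrite invf_lt1 ?ltr0n ?prime_gt0 // ltr1n prime_gt1.
rewrite yE; move: (vali y) uE => v -> /residue_dvd[z ->]; exists (w * z).
by rewrite -mulrA (mulrA u) wu mul1r.
Qed.

End PadicIntegers.

(** * The absolute value of Q_p *)

Section PadicNumbers.
Variables (p : nat) (p_pr : prime p).
Local Notation Qp := (padic p_pr).
Implicit Types x y : Qp.

Let p_gt0 : 0 < p%:R :> rat. Proof. by rewrite ltr0n prime_gt0. Qed.

Lemma padic_abs0 : padic_abs (0 : Qp) = 0.
Proof. by apply/eqP; rewrite padic_abs_eq0. Qed.

Lemma padic_abs1 : padic_abs (1 : Qp) = 1.
Proof. by rewrite -(rmorph1 (@padic_of_int p p_pr)) padic_abs_of_int absi1. Qed.

Lemma padic_absV x : padic_abs x^-1 = (padic_abs x)^-1.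
Proof.
have [->|x0] := eqVneq x 0; first by rewrite invr0 padic_abs0 invr0.
apply: (@mulfI _ (padic_abs x)); first by rewrite padic_abs_eq0.
by rewrite -padic_absM !mulfV ?padic_abs1 // padic_abs_eq0.
Qed.

Lemma padic_absX x n : padic_abs (x ^+ n) = padic_abs x ^+ n.
Proof.
elim: n => [|n IHn]; first by rewrite padic_abs1.
by rewrite !exprS padic_absM IHn.
Qed.

Lemma padic_abs_exp n : padic_abs (p%:R ^+ n : Qp) = p%:R ^- n.
Proof. by rewrite padic_absX padic_abs_p exprVn. Qed.

Lemma padic_p_neq0 : p%:R != 0 :> Qp.
Proof. by rewrite -padic_abs_eq0 padic_abs_p invr_eq0 gt_eqF. Qed.

Lemma padic_abs_gt0 x : (0 < padic_abs x) = (x != 0).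
Proof. by rewrite lt_def padic_abs_ge0 andbT padic_abs_eq0. Qed.

Lemma absi_le1 (a : padic_int p_pr) : absi a <= 1.
Proof.
rewrite /absi; case: eqP => // _; rewrite invf_le1 ?exprn_gt0 //.
by rewrite exprn_ege1 // ler1n prime_gt0.
Qed.

Lemma padic_intE x : padic_abs x <= 1 -> exists a, x = padic_of_int a.
Proof.
have [a [b [b0 -> ->]]] := padic_fracP x.
rewrite ler_pdivrMr ?mul1r; last by rewrite lt_def absi_eq0 b0 absi_ge0.
move=> /(absi_dvd b0)[c ->]; exists c.
by rewrite rmorphM mulrC mulKf ?padic_of_int_eq0.
Qed.

(** The value group is generated by p, so nothing lies strictly between
    |y| / p and |y|. *)
Lemma padic_abs_gap x y : padic_abs x < padic_abs y ->
  padic_abs x <= p%:R^-1 * padic_abs y.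
Proof.
move=> xy; have y0 := le_lt_trans (padic_abs_ge0 x) xy.
rewrite -ler_pdivrMr // -padic_absV -padic_absM.
have : padic_abs (x / y) < 1 by rewrite padic_absM padic_absV ltr_pdivrMr ?mul1r.
move=> xy1; have [a aE] := padic_intE (ltW xy1).
move: xy1; rewrite aE padic_abs_of_int -[X in _ -> _ <= X^-1]expr1 absi_le /absi.
case: eqP => //= _; case: (vali a) => //; by rewrite expr0 invr1 ltxx.
Qed.

Lemma padic_abs_exprz x : x != 0 ->
  exists k : int, padic_abs x = padic_abs (p%:R ^ k : Qp).
Proof.
have [a [b [b0 -> ->]]] := padic_fracP x.
have [->|a0 _] := eqVneq a 0; first by rewrite rmorph0 mul0r eqxx.
exists ((vali a)%:Z - (vali b)%:Z); rewrite expfzDr ?padic_p_neq0 // padic_absM.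
rewrite -exprnN -exprnP padic_absV !padic_abs_exp.
by rewrite /absi (negbTE a0) (negbTE b0).
Qed.

Lemma exp_p_unbounded (F : archiRealFieldType) (c : F) :
  exists n, c < p%:R ^+ n.
Proof.
exists (Num.bound `|c|); rewrite (le_lt_trans (ler_norm c)) //.
rewrite (lt_trans (archi_boundP (normr_ge0 c))) // -natrX ltr_nat.
by rewrite ltn_expl // prime_gt1.
Qed.

Lemma exp_p_small (e : rat) : 0 < e -> exists n, p%:R ^- n < e.
Proof.
move=> e0; have [n en] := exp_p_unbounded e^-1; exists n.
by rewrite invf_plt // posrE ?exprn_gt0.
Qed.

End PadicNumbers.

(** * Lattices and balls *)

Lemma ultra_pigeonhole (T : Type) (F : set_system T) (A : nat -> set T) N :
  UltraFilter F -> F [set x | exists2 k, (k < N)%N & A k x] ->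
  exists k, F (A k).
Proof.
move=> FU; elim: N => [|N IHN] FA.
  by case: (filter_ex FA) => x [].
have [FAN|FAN] := in_ultra_setVsetC (A N) FU; first by exists N.
apply: IHN; apply: filterS (filterI FA FAN) => x [[k kN Akx] NANx].
exists k => //; move: kN; rewrite ltnS leq_eqVlt => /predU1P[kN|//].
by case: NANx; rewrite -kN.
Qed.

Section Lattices.
Variables (p : nat) (p_pr : prime p) (d : nat).
Local Notation Qp := (padic p_pr).
Local Notation V := 'cV[Qp]_d.
Implicit Types (L M : set V) (x y : V).

Definition cube (c : rat) : set V := [set x | forall i, padic_abs (x i 0) <= c].

Lemma nbhs_cube x (c : rat) : 0 < c -> nbhs x [set y | cube c (y - x)].
Proof.
move=> c0; exists (fun i j => ball (x i j) c) => [i j|y xy i].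
  exact: nbhsx_ballx.
have := xy i 0; rewrite ballEmdist /= !mxE -padic_absN opprB.
exact: ltW.
Qed.

Lemma cube_nbhs x (A : set V) : nbhs x A ->
  exists n : nat, forall y, cube (p%:R ^- n) (y - x) -> A y.
Proof.
move=> [P Px PA].
have [e e0 Pe] : exists2 e : rat, 0 < e &
    forall i j z, padic_abs (x i j - z) < e -> P i j z.
  have /choice[e eP] (i : 'I_d) : exists e : rat,
      0 < e /\ forall z, padic_abs (x i 0 - z) < e -> P i 0 z.
    by have /nbhs_ballP[e /= e0 eP] := Px i 0; exists e.
  exists (\big[Order.min/1]_i e i).
    by apply/bigmin_gtP; split => // i _; have [] := eP i.
  by move=> i j z; rewrite (ord1 j) => /bigmin_gtP[_ /(_ i isT)]; exact: (eP i).2.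
have [n ne] := exp_p_small p_pr e0.
exists n => y xy; apply: PA => i j; apply: Pe.
rewrite -padic_absN opprB (le_lt_trans _ ne) // (ord1 j).
by have := xy i; rewrite !mxE.
Qed.

(** An ultrafilter on the cube selects, for every coordinate and every n,
    one residue class modulo p^n; these classes are coherent, so they are the
    residues of a p-adic integer, and c times it is the limit. *)
Lemma compact_cube (c : Qp) : c != 0 -> compact (cube (padic_abs c)).
Proof.
move=> c0; rewrite compact_ultra => F FU Fc.
have coord (i : 'I_d) : exists a : padic_int p_pr, forall n,
    F [set x : V |
      padic_abs (x i 0 - c * padic_of_int a) <= padic_abs c * p%:R ^- n].
  pose A n k := [set x : V |
    exists2 a : padic_int p_pr, x i 0 = c * padic_of_int a & a n = k].
  have /choice[f fP] n : exists k, F (A n k).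
    apply: (@ultra_pigeonhole _ _ _ (p ^ n)); apply: filterS Fc => x /(_ i) xc.
    have [|a aE] := @padic_intE _ p_pr (x i 0 / c).
      by rewrite padic_absM padic_absV ler_pdivrMr ?padic_abs_gt0 // mul1r.
    exists (a n); first exact: residue_lt.
    by exists a => //; rewrite -aE mulrC divfK.
  have fcoh n : (f n.+1 = f n %[mod p ^ n])%N.
    have [x [[a aE <-] [b bE <-]]] := filter_ex (filterI (fP n.+1) (fP n)).
    have -> : b = a.
      apply/eqP; rewrite -subr_eq0 -padic_of_int_eq0 rmorphB subr_eq0.
      by apply/eqP/(mulfI c0); rewrite -aE -bE.
    by rewrite -residueE modn_small ?residue_lt.
  exists (of_coherent p_pr fcoh) => n; apply: filterS (fP n) => x [a aE an] /=.
  rewrite aE -mulrBr -rmorphB padic_absM ler_pM2l ?padic_abs_gt0 //.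
  rewrite padic_abs_of_int; apply: absi_sub_residue.
  by rewrite /= -an modn_small ?residue_lt.
have {coord}/choice[a aP] := coord.
exists (\col_i (c * padic_of_int (a i))); split => [i|A].
  rewrite mxE padic_absM ler_piMr ?padic_abs_ge0 //.
  by rewrite padic_abs_of_int absi_le1.
move=> /cube_nbhs[n nA].
have [m mn] : exists m, p%:R ^- m < p%:R ^- n / padic_abs c.
  apply: (exp_p_small p_pr).
  by rewrite divr_gt0 ?padic_abs_gt0 // invr_gt0 exprn_gt0 // ltr0n prime_gt0.
have aPm : \forall x \near F, forall i,
    padic_abs ((x : V) i 0 - c * padic_of_int (a i)) <= padic_abs c * p%:R ^- m.
  by apply: filter_forall => i; exact: aP.
apply: filterS aPm => x xm; apply: nA => i.
rewrite !mxE (le_trans (xm i)) //.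
by rewrite mulrC -ler_pdivlMr ?padic_abs_gt0 // ltW.
Qed.

(** The cubes of radii p^n exhaust the space, and every point has
    a neighbourhood inside one of them. *)
Lemma compact_cube_sub L : compact L -> exists n : nat, L `<=` cube (p%:R ^+ n).
Proof.
move=> /compact_near_coveringP Lc.
have := Lc nat \oo (fun n x => cube (p%:R ^+ n) x) _.
case=> [x _|n _ nL]; last by exists n; exact: (nL n (leqnn n)).
have [n nx] : exists n : nat, cube (p%:R ^+ n) x.
  have [n nx] := exp_p_unbounded p_pr (\big[Order.max/0]_i padic_abs (x i 0)).
  exists n => i; apply/ltW; apply: le_lt_trans nx.
  exact: le_bigmax.
exists ([set y | cube 1 (y - x)], [set k | (n <= k)%N]).
  by split; [exact: nbhs_cube|exists n].
move=> [y k] /= [yx nk] i; rewrite -[y](subrK x) mxE.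
rewrite (le_trans (padic_absD _ _)) // ge_max; apply/andP; split.
  by rewrite (le_trans (yx i)) // exprn_ege1 // ler1n prime_gt0.
rewrite (le_trans (nx i)) // ler_eXn2l // ltr1n prime_gt1 //.
Qed.

Lemma submodule_scale L (c : Qp) x :
  padic_submodule L -> padic_abs c <= 1 -> L x -> L (c *: x).
Proof. by move=> [_ _ LZ] /padic_intE[a ->]; exact: LZ. Qed.

Lemma submoduleB L x y : padic_submodule L -> L x -> L y -> L (x - y).
Proof.
move=> LM Lx Ly; have [_ LD _] := LM; apply: LD => //; rewrite -scaleN1r.
by apply: submodule_scale => //; rewrite padic_absN padic_abs1.
Qed.

Lemma submodule_sum L (I : finType) (P : pred I) (f : I -> V) :
  padic_submodule L -> (forall i, P i -> L (f i)) -> L (\sum_(i | P i) f i).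
Proof. by case=> L0 LD _ Lf; apply: (big_ind L). Qed.

(** A submodule containing a cube is a union of cosets of it, and so is the
    complement; thus it is open and closed, and compact if it lies in another
    cube. *)
Lemma latticeP L : lattice L <->
  [/\ padic_submodule L, exists n : nat, cube (p%:R ^- n) `<=` L
    & exists n : nat, L `<=` cube (p%:R ^+ n)].
Proof.
split=> [[Lo Lc LM]|[LM [n nL] [m Lm]]].
  split=> //; last exact: compact_cube_sub.
  have [L0 _ _] := LM.
  have [n nL] := cube_nbhs (open_nbhs_nbhs (conj Lo L0)); exists n => x xn.
  by apply: nL; rewrite subr0.
have pn0 : 0 < p%:R ^- n :> rat by rewrite invr_gt0 exprn_gt0 // ltr0n prime_gt0.
have cosetP x y : cube (p%:R ^- n) (y - x) -> L y -> L x.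
  move=> /nL yx Ly; rewrite -(subKr y x); exact: submoduleB.
have cubeN x y : cube (p%:R ^- n) (y - x) -> cube (p%:R ^- n) (x - y).
  by move=> yx i; have := yx i; rewrite !mxE -padic_absN opprB.
split=> //.
  rewrite openE => x Lx; apply: filterS (nbhs_cube x pn0) => y /cubeN yx.
  exact: cosetP yx Lx.
have c0 : p%:R ^- m != 0 :> Qp by rewrite invr_neq0 // expf_neq0 // padic_p_neq0.
apply: subclosed_compact (compact_cube c0) _.
  rewrite -openC openE => x Lx; apply: filterS (nbhs_cube x pn0) => y yx Ly.
  exact: Lx (cosetP _ _ yx Ly).
by rewrite padic_absV padic_abs_exp invrK.
Qed.

Lemma lattice_cubes L (e c : rat) : padic_submodule L -> 0 < e ->
  cube e `<=` L -> L `<=` cube c -> lattice L.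
Proof.
move=> LM e0 eL Lc; apply/latticeP; split=> //.
  have [n ne] := exp_p_small p_pr e0; exists n => x xn; apply: eL => i.
  exact: le_trans (xn i) (ltW ne).
have [n cn] := exp_p_unbounded p_pr c; exists n => x /Lc xc i.
exact: le_trans (xc i) (ltW cn).
Qed.

Lemma padic_abs_sum (I : finType) (P : pred I) (f : I -> Qp) (c : rat) :
  0 <= c -> (forall i, P i -> padic_abs (f i) <= c) ->
  padic_abs (\sum_(i | P i) f i) <= c.
Proof.
move=> c0 fc; apply: (big_ind (fun z => padic_abs z <= c)) => //.
  by rewrite padic_abs0.
by move=> x y xc yc; rewrite (le_trans (padic_absD x y)) // ge_max xc.
Qed.

Lemma mulmx_cube (A : 'M[Qp]_d) :
  exists2 C : rat, 0 < C & forall (e : rat) x, 0 <= e ->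
    cube e x -> cube (C * e) (A *m x).
Proof.
pose C : rat := \big[Order.max/1]_(ij : 'I_d * 'I_d) padic_abs (A ij.1 ij.2).
have C0 : 0 < C by rewrite (lt_le_trans ltr01) // bigmax_ge_id.
exists C => // e x e0 xe i; rewrite mxE; apply: padic_abs_sum => [|j _].
  by rewrite mulr_ge0 // ltW.
rewrite padic_absM ler_pM ?padic_abs_ge0 //.
exact: (@le_bigmax _ _ _ 1 (fun ij => padic_abs (A ij.1 ij.2)) (i, j)).
Qed.

Lemma scale_setE (c : Qp) L x : c != 0 -> scale_set c L x <-> L (c^-1 *: x).
Proof.
move=> c0; split=> [[y Ly <-]|Lx]; first by rewrite scalerK.
by exists (c^-1 *: x) => //; rewrite scalerA divff ?scale1r.
Qed.

Lemma scale_setS (c : Qp) L M : L `<=` M -> scale_set c L `<=` scale_set c M.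
Proof. by move=> LM _ [x Lx <-]; exists x => //; exact: LM. Qed.

Lemma scale_lattice (c : Qp) L : c != 0 -> lattice L -> lattice (scale_set c L).
Proof.
move=> c0 /latticeP[[L0 LD LZ] [n nL] [m Lm]].
have cp : 0 < padic_abs c by rewrite padic_abs_gt0.
apply: (@lattice_cubes _ (padic_abs c * p%:R ^- n) (padic_abs c * p%:R ^+ m)).
- split=> [|x y|a x].
  + by apply/(scale_setE _ _ c0); rewrite scaler0.
  + move=> /(scale_setE _ _ c0) Lx /(scale_setE _ _ c0) Ly.
    by apply/(scale_setE _ _ c0); rewrite scalerDr; exact: LD.
  + move=> /(scale_setE _ _ c0) Lx; apply/(scale_setE _ _ c0).
    by rewrite scalerA mulrC -scalerA; exact: LZ.
- by rewrite mulr_gt0 // invr_gt0 exprn_gt0 // ltr0n prime_gt0.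
- move=> x xn; apply/(scale_setE _ _ c0); apply: nL => i.
  by rewrite mxE padic_absM padic_absV ler_pdivrMl.
- move=> x /(scale_setE _ _ c0)/Lm xm i; have := xm i.
  by rewrite mxE padic_absM padic_absV ler_pdivrMl.
Qed.

(** Units of Z_p preserve a submodule, so only the absolute value of
    a scaling factor matters. *)
Lemma scale_submodule_le (c c' : Qp) L : padic_submodule L -> c' != 0 ->
  padic_abs c <= padic_abs c' -> scale_set c L `<=` scale_set c' L.
Proof.
move=> LM c'0 cc' _ [x Lx <-]; apply/(scale_setE _ _ c'0); rewrite scalerA.
apply: submodule_scale => //.
by rewrite padic_absM padic_absV ler_pdivrMl ?padic_abs_gt0 // mulr1.
Qed.

Lemma scale_submodule_eq (c c' : Qp) L : padic_submodule L ->
  c != 0 -> c' != 0 -> padic_abs c = padic_abs c' ->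
  scale_set c L = scale_set c' L.
Proof.
by move=> LM c0 c'0 cc'; apply/seteqP; split;
  apply: scale_submodule_le; rewrite ?cc'.
Qed.

Lemma gamma_orbit_lattice L : lattice L -> gamma_orbit L = lattice_class L.
Proof.
move=> Ll; have [_ _ LM] := Ll; have p0 := padic_p_neq0 p_pr.
apply/seteqP; split=> [_ [k ->]|M [_ [c c0 ->]]].
  split; last by exists (p%:R ^ k); rewrite ?expfz_neq0.
  by apply: scale_lattice; rewrite ?expfz_neq0.
have [k ck] := padic_abs_exprz c0; exists k.
exact: (scale_submodule_eq LM c0 (expfz_neq0 k p0) ck).
Qed.

(** Write M = c L: the first case is |c| >= 1, and otherwise |c| <= 1/p. *)
Lemma lattice_class_eq L M : lattice L -> lattice M ->
  lattice_class L = lattice_class M -> L `<=` M \/ M `<=` dilate 1 L.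
Proof.
move=> [_ _ LM] Ml LMe; have p0 := padic_p_neq0 p_pr.
have : lattice_class M M.
  split=> //; exists 1; rewrite ?oner_neq0 //.
  by apply/seteqP; split=> x; rewrite scale_setE ?oner_neq0 // invr1 scale1r.
rewrite -LMe => -[_ [c c0 Mc]]; rewrite {}Mc.
have [c1|c1] := leP 1 (padic_abs c).
  left=> x Lx; apply/scale_setE => //; apply: submodule_scale => //.
  by rewrite padic_absV invf_le1 ?padic_abs_gt0.
right; apply: (scale_submodule_le LM (expfz_neq0 1 p0)).
rewrite expr1z padic_abs_p; have := @padic_abs_gap _ p_pr c 1.
by rewrite padic_abs1 mulr1; apply.
Qed.

Section Balls.
Variable R : realType.
Implicit Types (q : 'I_d -> R) (A : 'M[Qp]_d).

Lemma pnorm_le q (z : V) (r : R) : 0 <= r ->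
  pnorm q z <= r <-> forall i, q i * ratr (padic_abs (z i 0)) <= r.
Proof.
move=> r0; split=> [/bigmax_leP[_ zr] i|zr]; first exact: zr.
by apply/bigmax_leP; split.
Qed.

Lemma pnorm_ball_submodule q A (r : R) : (forall i, 0 < q i) -> 0 <= r ->
  padic_submodule [set y : V | pnorm q (A *m y) <= r].
Proof.
move=> q0 r0; split=> [|x y|a x] /=; rewrite !pnorm_le //.
- by move=> i; rewrite mulmx0 mxE padic_abs0 rmorph0 mulr0.
- move=> xr yr i; rewrite mulmxDr mxE.
  have := padic_absD ((A *m x) i 0) ((A *m y) i 0).
  rewrite le_max => /orP[] le_abs.
    by rewrite (le_trans _ (xr i)) // ler_pM2l // ler_rat.
  by rewrite (le_trans _ (yr i)) // ler_pM2l // ler_rat.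
- move=> xr i; rewrite -scalemxAr mxE (le_trans _ (xr i)) // ler_pM2l // ler_rat.
  by rewrite padic_absM ler_piMl ?padic_abs_ge0 // padic_abs_of_int absi_le1.
Qed.

(** Every point of an ultrametric ball is a centre of it. *)
Lemma ball0E A q I : (forall i, 0 < q i) -> is_ball0 (pmetric A q) I <->
  exists2 r, 0 < r & I = [set y | pnorm q (A *m y) <= r].
Proof.
move=> q0; split=> [[[x [r [r0 ->]]] /= x0]|[r r0 ->]]; last first.
  have [B0 _ _] := pnorm_ball_submodule A q0 (ltW r0); split => //.
  exists 0, r; split=> //; apply/seteqP; split=> y /=.
    rewrite /pmetric sub0r mulmxN !pnorm_le ?ltW // => yr i.
    by rewrite mxE padic_absN.
  rewrite /pmetric sub0r mulmxN !pnorm_le ?ltW // => yr i.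
  by have := yr i; rewrite mxE padic_absN.
have BM := pnorm_ball_submodule A q0 (ltW r0).
exists r => //; apply/seteqP; rewrite /pmetric subr0 in x0 *; split=> y /= xy.
  by rewrite -(subKr x y); exact: submoduleB BM x0 xy.
exact: submoduleB BM x0 xy.
Qed.

Lemma ball_lattice I : balls0 R p_pr d I -> lattice I.
Proof.
case=> _ [A [q [Au q0 ->]]] /(ball0E _ _ q0)[r r0 ->].
have [C C0 CA] := mulmx_cube A; have [C' C'0 CA'] := mulmx_cube (invmx A).
have rC0 : 0 < ratr C :> R by rewrite ltr0q.
have [n qn] := exp_p_unbounded p_pr (\big[Order.max/0]_i (q i * ratr C / r)).
have [m rm] := exp_p_unbounded p_pr (\big[Order.max/0]_i (r / q i)).
have pn0 k : 0 < p%:R ^+ k :> rat by rewrite exprn_gt0 // ltr0n prime_gt0.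
have pR0 k : 0 < p%:R ^+ k :> R by rewrite exprn_gt0 // ltr0n prime_gt0.
apply: (@lattice_cubes _ (p%:R ^- n) (C' * p%:R ^+ m)).
- exact: pnorm_ball_submodule (ltW r0).
- by rewrite invr_gt0.
- move=> x xn /=; rewrite pnorm_le ?ltW // => i.
  have /CA xC : 0 <= p%:R ^- n :> rat by rewrite invr_ge0 ltW.
  rewrite (@le_trans _ _ (q i * ratr (C * p%:R ^- n))) //.
    by rewrite ler_pM2l // ler_rat; exact: xC.
  rewrite rmorphM fmorphV rmorphXn /= ratr_nat mulrA ler_pdivrMr //.
  rewrite -ler_pdivrMl // mulrC.
  exact: le_trans (le_bigmax _ (fun i => q i * ratr C / r) i) (ltW qn).
- move=> x /=; rewrite pnorm_le ?ltW // => xr.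
  rewrite -(mulKmx Au x); apply: CA'; first exact: ltW.
  move=> i; rewrite -(ler_rat R) rmorphXn /= ratr_nat.
  apply: le_trans (ltW rm); apply: le_trans (le_bigmax _ (fun i => r / q i) i).
  by rewrite ler_pdivlMr // mulrC.
Qed.

End Balls.

End Lattices.

(** * Chains of lattices and adapted bases *)

Section AdaptedBasis.
Variables (p : nat) (p_pr : prime p) (d : nat).
Local Notation Qp := (padic p_pr).
Local Notation V := 'cV[Qp]_d.

Let p_gt0 : 0 < p%:R :> rat. Proof. by rewrite ltr0n prime_gt0. Qed.
Let p_neq0 := padic_p_neq0 p_pr.


(** The standard flag, in the order that makes the matrix of a basis adapted
    to it lower triangular. *)
Definition flag j : set V := [set x | forall i : 'I_d, (i < j)%N -> x i 0 = 0].

(** The j-th coordinates of the vectors of L in the j-th step of the flag have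
    bounded absolute values, and these form a discrete set, so one of them is
    maximal; it is not 0 since L contains a nonzero multiple of the
    j-th standard vector. *)
Lemma leading_vector (L : set V) (j : 'I_d) : lattice L ->
  exists b, [/\ L b, flag j b, b j 0 != 0
    & forall x, L x -> flag j x -> padic_abs (x j 0) <= padic_abs (b j 0)].
Proof.
move=> /latticeP[LM [n nL] [m Lm]].
have pm0 : 0 < p%:R ^+ m :> rat by rewrite exprn_gt0.
have valE x : L x -> x j 0 != 0 ->
    exists k : nat, padic_abs (x j 0) = p%:R ^+ m * p%:R ^- k.
  move=> Lx x0; have [|a aE] := @padic_intE _ _ (x j 0 * p%:R ^+ m).
    by rewrite padic_absM padic_abs_exp ler_pdivrMr // mul1r; exact: Lm.
  have a0 : a != 0 
    by rewrite -padic_of_int_eq0 -aE (mulf_neq0 x0 (expf_neq0 m p_neq0)).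
  exists (vali a); have := padic_abs_of_int a.
  rewrite -aE padic_absM padic_abs_exp {1}/absi (negbTE a0) => <-.
  by rewrite mulrC divfK ?gt_eqF.
pose P k := `[< exists b,
  [/\ L b, flag j b & padic_abs (b j 0) = p%:R ^+ m * p%:R ^- k] >].
have exP : exists k, P k.
  pose e : V := \col_i (if i == j then p%:R ^+ n else 0).
  have Le : L e.
    apply: nL => i; rewrite mxE; case: eqP => _; first by rewrite padic_abs_exp.
    by rewrite padic_abs0 invr_ge0 exprn_ge0 // ltW.
  have ej : e j 0 = p%:R ^+ n by rewrite mxE eqxx.
  have [|k kE] := valE e Le; first by rewrite ej (expf_neq0 n p_neq0).
  exists k; apply/asboolP; exists e; split=> // i ij.
  by rewrite mxE ifN // neq_ltn ij.
case: (ex_minnP exP) => k /asboolP[b [Lb bj bk]] kmin.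
have b0 : b j 0 != 0.
  by rewrite -padic_abs_eq0 bk mulf_neq0 ?invr_eq0 ?gt_eqF // exprn_gt0.
exists b; split; [exact: Lb|exact: bj|exact: b0|move=> x Lx xj].
have [->|x0] := eqVneq (x j 0) 0.
  by rewrite padic_abs0 padic_abs_ge0.
have [l lE] := valE x Lx x0; have lk : (k <= l)%N.
  by apply: kmin; apply/asboolP; exists x.
rewrite lE bk ler_pM2l // lef_pV2 ?posrE ?exprn_gt0 //.
by rewrite ler_eXn2l // ltr1n prime_gt1.
Qed.

(** If b first appears in a chain of lattices p L_m < L_0 < ... < L_m at
    level t, then c b lies in L_i for every c of absolute value at most
    this bound, because p b lies in L_0. *)
Definition level_bound (t i : nat) : rat := if (t <= i)%N then 1 else p%:R^-1.

Section Chain.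
Variables (m : nat) (L : 'I_m.+1 -> set V).
Hypothesis latL : forall i, lattice (L i).
Hypothesis leL : forall i j : 'I_m.+1, (i <= j)%N -> L i `<=` L j.
Hypothesis pL : dilate 1 (L ord_max) `<=` L ord0.

(** Take b with j-th coordinate of the largest absolute value possible in the
    top lattice, at the first level t where it occurs. Below this level the
    j-th coordinates are strictly smaller, so smaller by a factor p. *)
Lemma adapted_vector (j : 'I_d) : exists (b : V) (t : 'I_m.+1),
  [/\ flag j b, b j 0 != 0,
      forall (i : 'I_m.+1) (c : Qp),
        padic_abs c <= level_bound t i -> L i (c *: b)
    & forall (i : 'I_m.+1) x, L i x -> flag j x ->
        padic_abs (x j 0) <= level_bound t i * padic_abs (b j 0)].
Proof.
have [b0 [Lb0 fb0 b0j b0max]] := leading_vector j (latL ord_max).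
pose P (i : 'I_m.+1) := `[< exists b,
  [/\ L i b, flag j b & padic_abs (b j 0) = padic_abs (b0 j 0)] >].
have Pmax : P ord_max by apply/asboolP; exists b0.
case: (arg_minnP (fun i : 'I_m.+1 => i : nat) Pmax).
move=> t /asboolP[b [Lb fb bE]] tmin.
have Lib (i : 'I_m.+1) : (t <= i)%N -> L i b by move=> ti; exact: leL Lb.
exists b, t; split.
- exact: fb.
- by rewrite -padic_abs_eq0 bE padic_abs_eq0.
- move=> i c; rewrite /level_bound; have [_ _ LM] := latL i.
  case: leqP => [ti c1|it cp]; first by apply: submodule_scale => //; exact: Lib.
  have Lpb : L i (p%:R *: b).
    apply: (leL (leq0n i : (@ord0 m <= i)%N)); apply: pL.
    exists b; last by rewrite expr1z.
    by apply: Lib; rewrite -ltnS ltn_ord.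
  have -> : c *: b = (c / p%:R) *: (p%:R *: b) by rewrite scalerA (divfK p_neq0).
  apply: submodule_scale => //; rewrite padic_absM padic_absV padic_abs_p.
  by rewrite ler_pdivrMr ?mul1r // invr_gt0.
- move=> i x Lx fx; have xb : padic_abs (x j 0) <= padic_abs (b j 0).
    by rewrite bE; apply: b0max => //; apply: leL Lx; rewrite -ltnS ltn_ord.
  rewrite /level_bound; case: leqP => [_|it]; first by rewrite mul1r.
  apply: padic_abs_gap; rewrite lt_neqAle xb andbT; apply/eqP => xbE.
  have : (t <= i)%N by apply: tmin; apply/asboolP; exists x; rewrite xbE.
  by rewrite leqNgt it.
Qed.

(** The j-th coordinate in the basis is controlled once the earlier ones are:
    subtracting the terms with index < j keeps the vector in the lattice L_i and
    moves it into the j-th step of the flag, where [adapted_vector] applies. *)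
Lemma adapted_basis : exists (A : 'M[Qp]_d) (t : 'I_d -> 'I_m.+1),
  A \in unitmx /\ forall (i : 'I_m.+1) (x : V),
    L i x <-> forall j, padic_abs ((A *m x) j 0) <= level_bound (t j) i.
Proof.
have [b /choice[t bP]] := choice adapted_vector.
pose B := \matrix_(i, j) b j i 0.
have Bx (x : V) : B *m x = \sum_j x j 0 *: b j.
  apply/matrixP => i k; rewrite (ord1 k) mxE summxE; apply: eq_bigr => j _.
  by rewrite !mxE mulrC.
have Bu : B \in unitmx.
  rewrite unitmxE det_trig.
    rewrite unitfE prodf_seq_neq0; apply/allP => j _ /=; rewrite mxE.
    by have [_ bj _ _] := bP j.
  apply/is_trig_mxP => i j ij; rewrite mxE; have [fb _ _ _] := bP j; exact: fb.
exists (invmx B), t; split=> [|i x]; first by rewrite unitmx_inv.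
rewrite -{1}[x](mulKVmx Bu); move: (invmx B *m x) => {}x.
have [_ _ LM] := latL i; rewrite Bx; split=> [LBx|xt]; last first.
  by apply: submodule_sum => // j _; have [_ _ + _] := bP j; apply.
suff H n : forall j : 'I_d, (j < n)%N -> padic_abs (x j 0) <= level_bound (t j) i.
  by move=> j; exact: (H d).
elim: n => // n IHn j; rewrite ltnS leq_eqVlt => /predU1P[jn|]; last exact: IHn.
pose y := \sum_(k < d | ~~ (k < n)%N) x k 0 *: b k.
have Ly : L i y.
  have -> : y = \sum_k x k 0 *: b k - \sum_(k < d | (k < n)%N) x k 0 *: b k.
    by rewrite (bigID (fun k : 'I_d => (k < n)%N)) /= addrC addrK.
  apply: submoduleB => //; apply: submodule_sum => // k kn.
  by have [_ _ + _] := bP k; apply; exact: IHn.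
have fy : flag j y.
  move=> k kj; rewrite summxE big1 // => l; rewrite -leqNgt => nl; rewrite mxE.
  have [fl _ _ _] := bP l; rewrite fl ?mulr0 //.
  by apply: leq_trans kj _; rewrite jn.
have [_ bj _ bmax] := bP j; have := bmax i y Ly fy.
have -> : y j 0 = x j 0 * b j j 0.
  rewrite summxE (bigD1 j) /=; last by rewrite jn ltnn.
  rewrite big1 ?addr0 ?mxE // => k /andP[]; rewrite -leqNgt => nk kj.
  have [fk _ _ _] := bP k; rewrite mxE fk ?mulr0 //.
  by rewrite ltn_neqAle eq_sym kj jn.
by rewrite padic_absM ler_pM2r // padic_abs_gt0.
Qed.

End Chain.

Lemma pchain_le m (L : 'I_m.+1 -> set V) (i j : 'I_m.+1) :
  pchain L -> (i <= j)%N -> L i `<=` L j.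
Proof.
by case=> _ ltL; rewrite leq_eqVlt => /predU1P[/val_inj->//|/ltL/properW].
Qed.

(** The ratio r i / r t lies in ]1/2, 2[, hence in ]1/p, p[, so comparing it
    with 0 or a power of p only depends on whether it is at least 1. *)
Lemma level_boundP (R : realType) (r : nat -> R) (t i : nat) (z : Qp) :
  {mono r : a b / (a <= b)%N >-> a <= b} -> 1 <= r t < 2 -> 1 <= r i < 2 ->
  r t * ratr (padic_abs z) <= r i <-> padic_abs z <= level_bound t i.
Proof.
move=> rmono /andP[t1 t2] /andP[i1 i2].
have p2 : 2 <= p%:R :> rat by rewrite ler_nat prime_gt1.
rewrite /level_bound; case: leqP => ti.
  have {ti} : r t <= r i by rewrite rmono.
  have [z1|z1] := leP (padic_abs z) 1 => rti; split=> // H.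
    apply: le_trans rti; rewrite ler_piMr //; first exact: le_trans t1.
    by rewrite -(rmorph1 (@ratr R)) ler_rat.
  have : 2 <= padic_abs z.
    apply: (le_trans p2); have := @padic_abs_gap _ p_pr 1 z.
    by rewrite padic_abs1 ler_pdivlMl // mulr1; apply.
  rewrite -(ler_rat R) ratr_nat => z2.
  have : 2 <= r t * ratr (padic_abs z) by rewrite -[2]mul1r ler_pM.
  by move=> /le_trans /(_ H); rewrite leNgt i2.
have {ti} rti : r i < r t by rewrite ltNge rmono -ltnNge.
have [z1|z1] := leP (padic_abs z) p%:R^-1; split=> // H.
  have zr : ratr (padic_abs z) <= 2^-1 :> R.
    rewrite -[2](ratr_nat R) -fmorphV ler_rat (le_trans z1) //.
    by rewrite lef_pV2.
  apply: (@le_trans _ _ 1) => //; rewrite (@le_trans _ _ (r t * 2^-1)) //.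
    by rewrite ler_pM2l // (lt_le_trans ltr01).
  by rewrite ler_pdivrMr // mul1r ltW.
have : 1 <= padic_abs z.
  rewrite leNgt; apply/negP => zlt; have := @padic_abs_gap _ p_pr z 1.
  by rewrite padic_abs1 mulr1 => /(_ zlt); rewrite leNgt z1.
rewrite -(ler_rat R) rmorph1 => z2.
have : r t <= r t * ratr (padic_abs z) by rewrite ler_peMr // (le_trans ler01).
by move=> /le_trans /(_ H); rewrite leNgt rti.
Qed.

Lemma chain_balls (R : realType) m (L : 'I_m.+1 -> set V) :
  (forall i, lattice (L i)) -> pchain L ->
  exists2 s, pmetrics (R := R) s & forall i, is_ball0 s (L i).
Proof.
move=> latL chL; have [pL ltL] := chL.
have leL (i j : 'I_m.+1) := @pchain_le m L i j chL.
have [A [t [Au AL]]] := adapted_basis latL leL (properW pL).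
pose r (i : nat) : R := 1 + i%:R / m.+1%:R.
have rmono : {mono r : a b / (a <= b)%N >-> a <= b}.
  by move=> a b; rewrite lerD2l ler_pM2r ?invr_gt0 ?ltr0n // ler_nat.
have r12 (i : 'I_m.+1) : 1 <= r i < 2.
  rewrite lerDl divr_ge0 //= -[2]/(1 + 1) ltrD2l ltr_pdivrMr ?ltr0n //.
  by rewrite mul1r ltr_nat ltn_ord.
have r0 (i : 'I_m.+1) : 0 < r i.
  by have /andP[r1 _] := r12 i; exact: lt_le_trans r1.
exists (pmetric A (fun j => r (t j))).
  by exists A, (fun j => r (t j)).
move=> i; apply/ball0E => //; exists (r i) => //.
apply/seteqP; split=> y /=; rewrite AL pnorm_le ?ltW // => yi j.
  exact/level_boundP.
by have := yi j; rewrite level_boundP.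
Qed.

(** If no basis vector appeared at level k, then L_k would be contained in
    L_(k - 1), or in p L_m for k = 0. *)
Lemma chain_length m (L : 'I_m.+1 -> set V) :
  (forall i, lattice (L i)) -> pchain L -> (m < d)%N.
Proof.
move=> latL chL; have [pL ltL] := chL.
have leL (i j : 'I_m.+1) := @pchain_le m L i j chL.
have [A [t [Au AL]]] := adapted_basis latL leL (properW pL).
suff /choice[g gK] k : exists j, t j = k.
  have /leq_card : injective g by apply: (can_inj (g := t)).
  by rewrite !card_ord.
apply: contrapT => /forallNP tk; case: k => -[|k] km in tk.
  case: pL => _; apply => x; have -> : ord0 = Ordinal km by exact: val_inj.
  move=> /AL xt; apply/(scale_setE _ _ (expfz_neq0 1 p_neq0)).
  apply/AL => j; rewrite -scalemxAr mxE.
  rewrite expr1z padic_absM padic_absV padic_abs_p invrK.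
  rewrite -ler_pdivlMl // /level_bound -ltnS ltn_ord mulr1.
  have := xt j; rewrite /level_bound ifN // leqn0.
  by apply/eqP => tj; apply: (tk j); exact: val_inj.
have [//|_] := ltL (Ordinal (ltnW km)) (Ordinal km); apply=> x /AL xt.
apply/AL => j; apply: le_trans (xt j) _; rewrite /level_bound /=.
have -> // : (t j <= k.+1)%N = (t j <= k)%N.
rewrite leq_eqVlt; case: eqP => [tj|//]; case: (tk j); exact: val_inj.
Qed.

End AdaptedBasis.

(** * The two complexes *)

Section Complexes.
Variables (p : nat) (p_pr : prime p) (d : nat).
Local Notation V := 'cV[padic p_pr]_d.

(** A vector of L with a leading coordinate of maximal absolute value is not
    p times a vector of L. *)
Lemma dilate_proper (L : set V) : (0 < d)%N -> lattice L -> dilate 1 L `<` L.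
Proof.
move=> d0 latL; have [_ _ LM] := latL; split.
  move=> _ [x Lx <-]; apply: submodule_scale => //.
  rewrite expr1z padic_abs_p invf_le1 ?ltr0n ?prime_gt0 //.
  by rewrite ler1n prime_gt0.
move=> LpL; have [b [Lb fb b0 bmax]] := leading_vector (Ordinal d0) latL.
have [c Lc cb] := LpL b Lb; have : flag (Ordinal d0) c by [].
move=> /(bmax c Lc); rewrite -cb mxE expr1z padic_absM padic_abs_p.
rewrite ler_pdivlMl ?ltr0n ?prime_gt0 //.
have c0 : 0 < padic_abs (c (Ordinal d0) 0).
  rewrite padic_abs_gt0; apply: contraNN b0 => /eqP c0.
  by rewrite -cb mxE c0 mulr0.
by rewrite ger_pMl // leNgt ltr1n prime_gt1.
Qed.

Lemma pchain_class_inj m (L : 'I_m.+1 -> set V) :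
  (forall i, lattice (L i)) -> pchain L ->
  injective (fun i => lattice_class (L i)).
Proof.
move=> latL chL i j; wlog ij : i j / (i < j)%N => [W e|].
  case: (ltngtP i j) => [/W|/W|/val_inj //]; first exact.
  by move=> /(_ (esym e)).
have [[_ pL] ltL] := chL => /esym e.
have [LijL|Lip] := lattice_class_eq (latL j) (latL i) e.
  by have [_ []] := ltL _ _ ij.
case: pL; apply: subset_trans (_ : _ `<=` L i) _.
  exact: (pchain_le chL (leq0n i : (@ord0 m <= i)%N)).
apply: (subset_trans Lip); apply: scale_setS; apply: (pchain_le chL).
by rewrite -ltnS ltn_ord.
Qed.

Lemma pchain_sub m m' (L : 'I_m.+1 -> set V) (h : 'I_m'.+1 -> 'I_m.+1) :
  pchain L -> {homo h : i j / (i < j)%N} -> pchain (L \o h).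
Proof.
move=> chL hh; have [[pL Lp] ltL] := chL; split=> [|i j /hh/ltL //].
have Lmax : dilate 1 (L (h ord_max)) `<=` dilate 1 (L ord_max).
  by apply: scale_setS; apply: (pchain_le chL); rewrite -ltnS ltn_ord.
have L0 := pchain_le chL (leq0n (h ord0) : (@ord0 m <= h ord0)%N).
split=> [x /Lmax/pL/L0 //|hLp]; apply: Lp => x /L0/hLp; exact: Lmax.
Qed.

Lemma increasing_enum m (P : set 'I_m.+1) : P !=set0 ->
  exists m' (h : 'I_m'.+1 -> 'I_m.+1),
    {homo h : i j / (i < j)%N} /\ range h = P.
Proof.
move=> [i0 Pi0]; pose s := [seq i <- enum 'I_m.+1 | `[< P i >]].
have sP i : (i \in s) = `[< P i >] by rewrite mem_filter mem_enum andbT.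
have i0s : i0 \in s by rewrite sP; apply/asboolP.
have ss : sorted (fun i j : 'I_m.+1 => i < j)%N s.
  apply: sorted_filter; first by move=> x y z; exact: ltn_trans.
  by have := iota_ltn_sorted 0 m.+1; rewrite -val_enum_ord sorted_map.
have s0 : (0 < size s)%N by case: (s) i0s.
exists (size s).-1, (fun k => nth ord0 s k).
have ks (k : 'I_(size s).-1.+1) : (k < size s)%N.
  by have := ltn_ord k; rewrite [in X in (_ < X)%N -> _](prednK s0).
split=> [i j ij|].
  apply: (sorted_ltn_nth (leT := fun i j : 'I_m.+1 => i < j)%N) => //.
  - by move=> x y z; exact: ltn_trans.
  - by rewrite inE ks.
  - by rewrite inE ks.
apply/seteqP; split=> [_ [k _ <-]|i Pi].
  by apply/asboolP; rewrite -sP mem_nth.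
have si : i \in s by rewrite sP; apply/asboolP.
have ik : (index i s < (size s).-1.+1)%N by rewrite prednK // index_mem.
by exists (Ordinal ik) => //=; rewrite nth_index.
Qed.

(** A face is the range of a subchain, whose inclusion p L_max < L_min follows
    from that of the whole chain. *)
Lemma bruhat_tits_simplicial : (0 < d)%N -> simplicial (bruhat_tits p_pr d).
Proof.
move=> d0; split=> /=.
- move=> _ [m [L [md latL chL Linj ->]]]; split.
  + exact: finite_image.
  + by exists (lattice_class (L ord0)); exists ord0.
  + by move=> _ [i _ <-]; exists (L i).
- move=> _ [L latL <-]; exists 0%N, (fun _ => L); split=> //.
  + by split=> [|i j]; [exact: dilate_proper|rewrite !ord1].
  + by move=> i j _; rewrite !ord1.
  + by apply/seteqP; split=> [_ ->|_ [i _ <-]//]; exists ord0.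
- move=> _ S' [m [L [md latL chL Linj ->]]] [v Sv] S'L.
  have [i0 _ vE] := S'L v Sv.
  have [|m' [h [hh hE]]] := @increasing_enum m [set i | S' (lattice_class (L i))].
    by exists i0; rewrite /= vE.
  exists m', (L \o h).
  have latLh i : lattice ((L \o h) i) by exact: latL.
  have chLh := pchain_sub chL hh; split=> //.
  + exact: chain_length latLh chLh.
  + exact: pchain_class_inj.
  + apply/seteqP; split=> [w Sw|_ [k _ <-]].
      have [i _ wE] := S'L w Sw.
      have : range h i by rewrite hE /= wE.
      by move=> [k _ kE]; exists k => //=; rewrite kE.
    by have : range h (h k) by [exists k]; rewrite hE.
Qed.

(** A lattice L is a chain by itself, since p L < L. *)
Lemma balls0E (R : realType) : (0 < d)%N -> balls0 R p_pr d = [set L | lattice L].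
Proof.
move=> d0; apply/seteqP; split=> [I|L latL]; first exact: ball_lattice.
have [||s sm Ls] := @chain_balls _ p_pr d R 0 (fun _ => L) => //.
  by split=> [|i j]; [exact: dilate_proper|rewrite !ord1].
by exists s => //; exact: Ls ord0.
Qed.

Lemma ball_complex_quotientE (R : realType) : (0 < d)%N ->
  ball_complex_quotient R p_pr d = bruhat_tits p_pr d.
Proof.
move=> d0; congr Complex => /=.
  by rewrite balls0E //; apply: eq_imagel => L; exact: gamma_orbit_lattice.
apply/seteqP; split=> [_ [_ [s sm [m [I [Is chI ->]]]] <-]|].
  have latI i : lattice (I i) by apply: (@ball_lattice _ _ _ R); exists s.
  exists m, I; split=> //.
  - exact: chain_length latI chI.
  - exact: pchain_class_inj.
  - rewrite image_comp; apply: eq_imagel => i _; exact: gamma_orbit_lattice.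
move=> _ [m [L [md latL chL Linj ->]]]; have [s sm Ls] := chain_balls R latL chL.
exists (range L); first by exists s => //; exists m, L.
rewrite image_comp; apply: eq_imagel => i _; exact: gamma_orbit_lattice.
Qed.

End Complexes.

Theorem mainTheorem1 (R : realType) (p : nat) (p_pr : prime p)
    (d : nat) (d_gt0 : (0 < d)%N) :
  (forall I, balls0 R p_pr d I -> lattice I) /\
  exists f : set (set 'cV[padic p_pr]_d) -> set (set 'cV[padic p_pr]_d),
    (forall I, balls0 R p_pr d I -> f (gamma_orbit I) = lattice_class I) /\
    simplicial_iso (ball_complex_quotient R p_pr d) (bruhat_tits p_pr d) f.
Proof.
split; first exact: ball_lattice.
exists id; split=> [I /ball_lattice|]; first exact: gamma_orbit_lattice.
have BT := bruhat_tits_simplicial p_pr d_gt0.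
rewrite ball_complex_quotientE //; split=> // [|S _]; last by rewrite image_id.
by split=> // v Kv; exists v.
Qed.
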